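(* Let $r\leq \log^{O(1)} m$. Any (possibly randomized) $r$-round algorithm that correctly solves \textsc{Template-Search} on instances with $|T|=m$ with probability at least $2/3$ must make $\Omega\!\left(m^{1/2^{r+3}}\right)$ queries.
   Context: \textsc{Template-Search}: an instance is a pair $(S,T)$ of non-decreasing arrays of real numbers with $|T|=m$ and $|S|=3m$, such that $T$ is a consecutive subarray of $S$, i.e. there is an integer $\Delta$ with $S_{i+\Delta}=T_i$ for all $1\le i\le m$. Given query access to both arrays (a query asks for the $i$-th element of $S$ or of $T$), the goal is to determine $\Delta$. An $r$-round algorithm proceeds in $r$ stages: in each stage it chooses a batch of queries that may depend only on answers from previous stages, then receives all answers; after $r$ stages it outputs its answer. Query complexity is the total number of queries. *)

(* Defs.v *)
From mathcomp Require Import all_boot all_order all_algebra.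
From mathcomp Require Import all_classical all_reals all_analysis.

Set Implicit Arguments.
Unset Strict Implicit.
Unset Printing Implicit Defensive.

Import Order.TTheory GRing.Theory Num.Theory.

Local Open Scope ring_scope.
Local Open Scope classical_set_scope.

Section TemplateSearch.
Variables (R : realType) (m : nat).
Implicit Types (S : 'I_(3 * m) -> R) (T : 'I_m -> R).

Definition nondecreasing_array n (A : 'I_n -> R) :=
  forall i j : 'I_n, (i <= j)%N -> A i <= A j.

(* S_(i + D) = T_i for all i, every index i + D being a position of S.
   Indices start at 0 in both arrays, which does not change the shift. *)
Definition is_shift S T (D : int) :=
  forall i : 'I_m, exists2 j : 'I_(3 * m), j%:Z = i%:Z + D & S j = T i.

Definition template_instance S T :=
  [/\ nondecreasing_array S, nondecreasing_array T & exists D, is_shift S T D].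

Definition query : Type := ('I_(3 * m) + 'I_m)%type.

Definition answer S T (x : query) : R :=
  match x with inl i => S i | inr i => T i end.

(* A deterministic r-round algorithm is a tree of depth r: each stage fixes a
   batch of k queries, k depending on the earlier answers too, and branches on
   the k answers. *)
Inductive algorithm : nat -> Type :=
| Output of int : algorithm 0
| Stage r k (batch : k.-tuple query) (next : k.-tuple R -> algorithm r) :
    algorithm r.+1.

Fixpoint output r (A : algorithm r) S T : int :=
  match A with
  | Output D => D
  | Stage _ _ batch next => output (next (map_tuple (answer S T) batch)) S T
  end.

Fixpoint num_queries r (A : algorithm r) S T : nat :=
  match A with
  | Output _ => 0%N
  | Stage _ k batch next =>
      (k + num_queries (next (map_tuple (answer S T) batch)) S T)%N
  end.

End TemplateSearch.

(* A randomized algorithm is a family of deterministic ones indexed by a random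
   seed w. Any valid shift is accepted when several exist. *)
Definition solves_with_probability (R : realType) (m r : nat)
    (d : measure_display) (W : measurableType d) (P : probability W R)
    (A : W -> algorithm R m r) (p : R) :=
  forall (S : 'I_(3 * m) -> R) (T : 'I_m -> R), template_instance S T ->
    let success := [set w | is_shift S T (output (A w) S T)] in
    measurable success /\ (p%:E <= P success)%E.

Definition makes_at_most (R : realType) (m r : nat) (W : Type)
    (A : W -> algorithm R m r) (q : nat) :=
  forall (S : 'I_(3 * m) -> R) (T : 'I_m -> R), template_instance S T ->
    forall w, (num_queries (A w) S T <= q)%N.

(* Main.v *)
Require Import Defs.
From mathcomp Require Import all_boot all_order all_algebra.
From mathcomp Require Import all_classical all_reals all_analysis.
From mathcomp Require Import measurable_realfun zify lra.

Import Order.TTheory GRing.Theory Num.Theory.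

Local Open Scope ring_scope.
Local Open Scope classical_set_scope.

(** Fix the template 0 1 1 ... 1 and let S be the step array whose last 0 is at
    position x, for x < 2m: the shift is then x and nothing else.  A batch of k
    queries to a step array has at most k + 1 possible answers, since the answers
    are monotone in x.  A deterministic r-round algorithm making at most q
    queries thus reaches at most (q + 1)^r leaves and is right for at most that
    many x.  Averaging over the random seed gives 2m * 2/3 <= (q + 1)^r, hence
    q + 1 >= m^(1/r), which is more than the bound claimed. *)

Section StepArrays.
Variables (R : realType) (m : nat).

Definition step_array {n : nat} (x : nat) (i : 'I_n) : R := (x < i)%N%:R.

Definition step_answer (x : nat) : query m -> R :=
  answer (step_array x) (step_array 0).

Lemma step_array_nondecreasing n x :
  nondecreasing_array (@step_array n x).
Proof.
move=> i j ij; rewrite /step_array ler_nat.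
by case: (ltnP x i) => // xi; rewrite (leq_trans xi ij).
Qed.

Lemma step_array_shift x : (x <= 2 * m)%N ->
  is_shift (@step_array (3 * m) x) (@step_array m 0) x%:Z.
Proof.
move=> xm i; have ixm : (i + x < 3 * m)%N by have := ltn_ord i; lia.
exists (Ordinal ixm); first by rewrite /= PoszD.
by rewrite /step_array /= -[X in (X < _)%N]add0n ltn_add2r.
Qed.

(** The template starts with 0 and then 1, so the step of [S] lies between positions [D] and
    [D + 1]: [D <= x < D + 1]. Two template entries are needed for this. *)
Lemma step_array_shift_uniq {x} {D : int} : (1 < m)%N ->
  is_shift (@step_array (3 * m) x) (@step_array m 0) D -> D = x%:Z.
Proof.
move=> m1 sD.
have [j0 /= j0E] := sD (Ordinal (ltnW m1)).
have [j1 /= j1E] := sD (Ordinal m1).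
rewrite /step_array /= => /eqP + /eqP; rewrite !eqr_nat.
by case: (ltnP x j1) => // ? _; case: (ltnP x j0) => // ? _; lia.
Qed.

Lemma step_array_instance x : (x <= 2 * m)%N ->
  template_instance (@step_array (3 * m) x) (@step_array m 0).
Proof.
move=> xm; split; try exact: step_array_nondecreasing.
by exists x%:Z; exact: step_array_shift.
Qed.

Definition count_ones {k} (batch : k.-tuple (query m)) (x : nat) : nat :=
  \sum_(i < k) (step_answer x (tnth batch i) == 1%R).

Lemma step_answerE x (u : query m) :
  step_answer x u = (step_answer x u == 1)%:R.
Proof.
case: u => i /=; rewrite /step_answer /= /step_array;
  by case: (_ < _)%N; rewrite ?eqxx // eq_sym oner_eq0.
Qed.

Lemma step_answer_anti x y (u : query m) : (x <= y)%N ->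
  ((step_answer y u == 1%R) <= (step_answer x u == 1%R))%N.
Proof.
move=> xy; case: u => i; rewrite /step_answer /=; last by rewrite leqnn.
rewrite /step_array !pnatr_eq1 !eqb1; case: (ltnP y i) => // yi.
by rewrite (leq_ltn_trans xy yi).
Qed.

(** As [x] grows, each answer can only drop from 1 to 0, so two answer vectors are comparable
    coordinatewise. Equal sums then force equality in every coordinate. *)
Lemma count_ones_inj {k} (batch : k.-tuple (query m)) x y :
  count_ones batch x = count_ones batch y ->
  map_tuple (step_answer x) batch = map_tuple (step_answer y) batch.
Proof.
wlog xy : x y / (x <= y)%N => [H|] cE.
  by have [/H->|/ltnW/H->] := leqP x y.
apply: eq_from_tnth => i; rewrite !tnth_map (step_answerE x) (step_answerE y).
have /leqif_sum : forall j : 'I_k, true ->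
    ((step_answer y (tnth batch j) == 1%R) <=
     (step_answer x (tnth batch j) == 1%R)
      ?= iff ((step_answer y (tnth batch j) == 1%R) ==
              (step_answer x (tnth batch j) == 1%R) :> nat))%N.
  by move=> j _; split=> //; exact: step_answer_anti.
case=> _; rewrite -/(count_ones batch y) -/(count_ones batch x) cE eqxx.
by move=> /esym/forallP/(_ i)/eqP ->.
Qed.

Lemma count_ones_ltS {k} (batch : k.-tuple (query m)) x :
  (count_ones batch x < k.+1)%N.
Proof.
rewrite ltnS -[leqRHS]card_ord -sum1_card; apply: leq_sum => i _.
exact: leq_b1.
Qed.

(** Induction on the tree. [X] plays the set of positions that lead to the current node; asking for
    the query bound on [X] only lets it pass to subtrees. *)
Lemma card_correct_step_arrays {N r q : nat} (A : algorithm R m r)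
    (X : {set 'I_N}) :
  {in X, forall x : 'I_N,
    (num_queries A (step_array x) (step_array 0) <= q)%N} ->
  (#|[set x in X | output A (@step_array _ x) (@step_array _ 0) == x%:Z]|
    <= q.+1 ^ r)%N.
Proof.
elim: A X => [D|{}r k batch next IH] X Xq /=.
  rewrite expn0; apply/card_le1_eqP => x y.
  rewrite !inE => /andP[_ /eqP ->] /andP[_ /eqP[xy]].
  exact/val_inj.
set Y := [set x in X | _]%SET.
(* A member of [X] is needed to bound the batch size [k] by [q]. *)
have [->|[x0 /[!inE] /andP[x0X _]]] := set_0Vmem Y; first by rewrite cards0.
have kq : (k <= q)%N by rewrite (leq_trans (leq_addr _ _) (Xq _ x0X)).
pose f (x : 'I_N) := Ordinal (count_ones_ltS batch x).
(* Split by the number of ones in the answers: [k + 1] classes, each to be bounded by [q.+1 ^ r]. *)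
rewrite -sum1_card (partition_big f predT)//= expnS.
apply: (@leq_trans (\sum_(c < k.+1) q.+1 ^ r)); last first.
  by rewrite sum_nat_const card_ord leq_mul2r ltnS kq orbT.
apply: leq_sum => c _; rewrite sum1dep_card.
pose Z := [set x in X | f x == c]%SET.
have [Z0|[x1]] := set_0Vmem Z.
  rewrite (_ : [set x | _]%SET = finset.set0) ?cards0//; apply/setP => x.
  have := congr1 (fun B : {set 'I_N} => x \in B) Z0; rewrite !inE.
  by case: (x \in X) => //= ->; rewrite andbF.
rewrite inE => /andP[x1X /eqP fx1].
(* All of [Z] yields the same answers [t], hence continues in the one subtree [next t]. *)
pose t := map_tuple (step_answer x1) batch.
have tE x : f x = c -> map_tuple (step_answer x) batch = t.
  by move=> fx; apply: count_ones_inj; apply: (congr1 val (etrans fx (esym fx1))).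
apply: leq_trans (IH t Z _) => [|x].
  apply/subset_leq_card/fintype.subsetP => x; rewrite !inE.
  move=> /andP[/andP[xX +] /eqP fx]; rewrite xX fx eqxx/=.
  by rewrite -/(step_answer x) tE.
rewrite inE => /andP[xX /eqP fx].
have := Xq _ xX; rewrite /= -/(step_answer x) tE//.
exact: leq_trans (leq_addl _ _).
Qed.

End StepArrays.

(** The sum is the expected number of events that occur, by linearity of the integral of indicators,
    and that number is at most [L] for every [w]. *)
Lemma sum_probability_le {R : realType} {d : measure_display}
    {W : measurableType d} (P : probability W R) (I : finType)
    (E : I -> set W) (L : nat) :
  (forall i, measurable (E i)) ->
  (forall w, (#|[set i | `[< E i w >]]%SET| <= L)%N) ->
  (\sum_(i : I) P (E i) <= L%:R%:E)%E.
Proof.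
move=> mE EL.
under eq_bigr do rewrite -[E _]setIT -integral_indic//.
rewrite -ge0_integral_sum//; last first.
  by move=> i; apply/measurable_EFinP; exact: measurable_indic.
apply: (@le_trans _ _ (\int[P]_(w in setT) (cst L%:R%:E w))%E); last first.
  by rewrite integral_cst// (_ : _ setT = 1%E) ?mule1//;
    exact: (@probability_setT _ _ _ P).
apply: ge0_le_integral => //.
- by move=> w _; apply: sume_ge0.
- apply: emeasurable_sum => i.
  by apply/measurable_EFinP; exact: measurable_indic.
- move=> w _ /=; rewrite sumEFin lee_fin.
  rewrite (le_trans _ (_ : #|[set i | `[< E i w >]]%SET|%:R <= _)) ?ler_nat//.
  rewrite -sum1_card natr_sum [leRHS]big_mkcond/=; apply: ler_sum => i _.
  by rewrite indicE !inE -[w \in E i]/(`[< E i w >]); case: asboolP.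
Qed.

Lemma solves_expn_ge {R : realType} {m r : nat} {d : measure_display}
    {W : measurableType d} (P : probability W R) (A : W -> algorithm R m r)
    (q : nat) : (1 < m)%N ->
  solves_with_probability P A (2 / 3) -> makes_at_most A q ->
  (m <= q.+1 ^ r)%N.
Proof.
move=> m1 solA qA.
have le2m (x : 'I_(2 * m)) : (x <= 2 * m)%N by exact: ltnW.
pose E (x : 'I_(2 * m)) : set W :=
  [set w | is_shift (@step_array R (3 * m) x) (@step_array R m 0)
             (output (A w) (@step_array R _ x) (@step_array R _ 0))].
have solE x : measurable (E x) /\ ((2 / 3)%:E <= P (E x))%E.
  exact: solA _ _ (step_array_instance R m x (le2m x)).
have cardE w : (#|[set x | `[< E x w >]]%SET| <= q.+1 ^ r)%N.
  apply: leq_trans (card_correct_step_arrays R m (A w) finset.setT _).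
    apply/subset_leq_card/fintype.subsetP => x; rewrite !inE/= => Exw.
    by apply/eqP; exact: (step_array_shift_uniq R m m1 Exw).
  by move=> x _; exact: qA (step_array_instance R m x (le2m x)) w.
have := sum_probability_le P _ E _ (fun x => (solE x).1) cardE.
move=> /(le_trans (lee_sum _ (fun x _ => (solE x).2))).
rewrite sumEFin lee_fin sumr_const card_ord => h.
(* The averaged sum is [4m/3], which is at least [m]. *)
rewrite -(ler_nat R); apply: le_trans h; rewrite -[leRHS]mulr_natr natrM.
have : 0 <= m%:R :> R by [].
lra.
Qed.

(** Taking roots gives [y] to the power [r / 2^n], an exponent at most 1, and [y >= 1]. *)
Lemma powR_inv_exp2_le {R : realType} (m r n : nat) (y : R) : 1 <= y ->
  m%:R <= y ^+ r -> (r <= 2 ^ n)%N -> m%:R `^ (2 ^+ n)^-1 <= y.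
Proof.
move=> y1 my rn; have y0 : 0 <= y by exact: le_trans y1.
apply: (@le_trans _ _ ((y ^+ r) `^ (2 ^+ n)^-1)).
  by rewrite ge0_ler_powR ?nnegrE ?invr_ge0 ?exprn_ge0.
rewrite -powR_mulrn// -powRrM -[leRHS]powRr1//.
apply: ler_powR => //; rewrite ler_pdivrMr ?exprn_gt0// mul1r.
by rewrite -natrX ler_nat.
Qed.

Theorem theorem7p3 (R : realType) (K : R) :
  exists2 c : R, 0 < c & exists m0 : nat,
  forall m r : nat, (m0 <= m)%N -> r%:R <= ln (m%:R : R) `^ K ->
  forall (d : measure_display) (W : measurableType d) (P : probability W R)
    (A : W -> algorithm R m r) (q : nat),
    solves_with_probability P A (2 / 3) ->
    makes_at_most A q ->
    c * m%:R `^ (2 ^+ (r + 3))^-1 <= q%:R.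
Proof.
(* The factor 1/2 absorbs the passage from [q + 1] to [q], as [q + 1 <= 2q] once [q >= 1]. *)
exists 2^-1; first by rewrite invr_gt0.
exists 2%N => m r m2 _ d W P A q solA qA.
have mq := solves_expn_ge P A q m2 solA qA.
(* With [q = 0] the bound would read [m <= 1]. *)
have q0 : (0 < q)%N.
  by rewrite lt0n; apply: contraTneq mq => ->; rewrite exp1n -ltnNge.
have : m%:R `^ (2 ^+ (r + 3))^-1 <= q.+1%:R :> R.
  apply: (@powR_inv_exp2_le _ m r); first by rewrite ler1n.
    by rewrite -natrX ler_nat.
  by rewrite (leq_trans (ltnW (ltn_expl r (ltnSn 1))))// leq_exp2l// leq_addr.
have : 1 <= q%:R :> R by rewrite ler1n.
rewrite -(natr1 q); lra.
Qed.
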